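(* (Right piece local cover theorem) Let $U$ be a right $i$-piece in the bottom-left packing of the subinstance $\mathcal{I}_i$ consisting of the first $i$ squares. Then $U$ can be covered by at most four copies of the squares adjacent to $U$; that is, there is a family of translates of squares adjacent to $U$, each used at most four times, whose union contains $U$.
   Context: Consider an instance of the Square Strip Packing Problem with strip width $W$ and an ordering $S_1,\dots,S_n$ with its bottom-left packing (each square in turn is placed, without overlapping interiors and inside $[0,W]\times[0,\infty)$, at the feasible position $(x,y)$ with $(y,x)$ lexicographically minimal). Squares are closed sets. $\mathcal{I}_i$ is the subinstance consisting of $S_1,\dots,S_i$. $i$-pieces: inductively for $i=1,\dots,n$, the $i$-pieces are the bounded connected components of $([0,W]\times[0,\infty))\setminus\big(\bigcup_{j\le i}S_j\cup\bigcup\{\text{$k$-pieces},\,k<i\}\big)$. A square $S$ is adjacent to a piece $U$ if $\overline U\cap S\ne\varnothing$. A piece is a right piece if its closure meets the right strip boundary $\{W\}\times\mathbb{R}_{\ge0}$. *)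

(* Defs.v *)
From HB Require Import structures.
From mathcomp Require Import all_boot all_order all_algebra.
From mathcomp Require Import all_classical all_reals all_analysis.
Set Implicit Arguments. Unset Strict Implicit. Unset Printing Implicit Defensive.
Import Order.TTheory GRing.Theory Num.Theory.
Import numFieldNormedType.Exports.
Local Open Scope classical_set_scope.
Local Open Scope ring_scope.

Section SSP.
Variable R : realType.

Definition csquare (q : R * R) (a : R) : set (R * R) :=
  [set z | q.1 <= z.1 <= q.1 + a /\ q.2 <= z.2 <= q.2 + a].

Definition osquare (q : R * R) (a : R) : set (R * R) :=
  [set z | q.1 < z.1 < q.1 + a /\ q.2 < z.2 < q.2 + a].

Definition strip (W : R) : set (R * R) :=
  [set z | 0 <= z.1 <= W /\ 0 <= z.2].

Definition feasible (W : R) (s : nat -> R) (p : nat -> R * R) (k : nat)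
  (q : R * R) : Prop :=
  csquare q (s k) `<=` strip W /\
  forall j, (j < k)%N -> osquare q (s k) `&` osquare (p j) (s j) = set0.

Definition BL_packing (W : R) (s : nat -> R) (n : nat) (p : nat -> R * R)
  : Prop :=
  forall k, (k < n)%N ->
    feasible W s p k (p k) /\
    forall q, feasible W s p k q ->
      (p k).2 < q.2 \/ ((p k).2 = q.2 /\ (p k).1 <= q.1).

(* the k-th placed square (0-based: squares S_1..S_n of the paper are
   indices 0..n-1) *)
Definition Sq (s : nat -> R) (p : nat -> R * R) (j : nat) : set (R * R) :=
  csquare (p j) (s j).

Definition bounded_set (A : set (R * R)) : Prop :=
  exists M : R, forall z, A z -> `|z.1| <= M /\ `|z.2| <= M.

Definition bounded_components (A : set (R * R)) : set (set (R * R)) :=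
  [set C | (exists x, A x /\ C = connected_component A x) /\ bounded_set C].

(* prev_pieces m = union of all m'-pieces for m' < m, where the m-pieces
   are the bounded components of strip minus the first m squares minus
   earlier pieces. *)
Fixpoint prev_pieces (W : R) (s : nat -> R) (p : nat -> R * R) (m : nat)
  : set (R * R) :=
  match m with
  | 0 => set0
  | m'.+1 =>
      prev_pieces W s p m' `|`
      \bigcup_(C in bounded_components
                 (strip W `\` (\bigcup_(j in [set j | (j < m')%N]) Sq s p j)
                          `\` prev_pieces W s p m')) C
  end.

Definition pieces (W : R) (s : nat -> R) (p : nat -> R * R) (i : nat)
  : set (set (R * R)) :=
  bounded_components
    (strip W `\` (\bigcup_(j in [set j | (j < i)%N]) Sq s p j)
             `\` prev_pieces W s p i).

Definition adjacent_to (S U : set (R * R)) : Prop :=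
  closure U `&` S !=set0.

Definition right_piece (W : R) (U : set (R * R)) : Prop :=
  closure U `&` [set z | z.1 = W /\ 0 <= z.2] !=set0.

End SSP.

(* Main.v *)
(* Every placed square [k] with lower left corner [(l, b)] and side [s]
   touches the wall or another square on its left, and the floor or another
   square below. Following these contacts from [k] gives two barriers, one
   to the left wall and one to the floor; since [U] reaches the right wall,
   no point of [U] lies in the corner region they enclose
   (chain_under_square).

   Use the translates of [k] with corners [(l + s, b)], [(l, b - s)],
   [(l + s, b - s)] and [(l + 2 s, b - s)]. Let [(x, y)] in [U] be
   uncovered, let [A] be the first square above it, and look left from the
   vertical segment between [(x, y)] and [A]. Going upwards, the visible
   squares recede to the left until the first one, [j], that overhangs free
   space ([j] may be [A]). For each visible [k] below that, induction on the
   height of its bottom gives [b + s - y < x - (l + s)]: if [b <= y] this is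
   because the first translate misses [(x, y)]. If [b > y], let [k1] be
   visible just below [b]; by minimality of the bottom-left position [k]
   does not fit to the right of [k1] at a lower height, so
   [s > x - r k1 > t k1 - y >= b - y] and, as the last two translates miss
   [(x, y)], [x - (l + s) > 2 s > s + (b - y)]. The same comparison for [j]
   yields [b j - y < s j] and [x < r j + s j], so that a translate of [j]
   below its bottom covers [(x, y)] after all. *)
Require Import Defs.
From HB Require Import structures.
From mathcomp Require Import all_boot all_order all_algebra.
From mathcomp Require Import all_classical all_reals all_analysis.
From mathcomp Require Import lra.
Set Implicit Arguments.
Unset Strict Implicit.
Unset Printing Implicit Defensive.
Import Order.TTheory GRing.Theory Num.Theory.
Import numFieldNormedType.Exports.
Local Open Scope classical_set_scope.
Local Open Scope ring_scope.

(** * Connectedness and finite families of reals *)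

(** The truth set of [P] is relatively open and relatively closed in [U]. *)
Lemma connected_locally_constant (T : topologicalType) (U : set T)
    (P : T -> bool) :
  connected U ->
  (forall z, U z -> \forall z' \near z, U z' -> P z' = P z) ->
  forall z z', U z -> U z' -> P z -> P z'.
Proof.
move=> Uc Ploc z z' Uz Uz' Pz.
suff /seteqP[_ /(_ z' Uz') [_ //]] : U `&` [set w | P w] = U.
apply: Uc.
- by exists z.
- exists (interior [set w | U w -> P w]); first exact: open_interior.
  apply/seteqP; split => w [Uw]; last first.
    by move=> /interior_subset /(_ Uw).
  move=> Pw; split=> //; apply: filterS (Ploc w Uw) => w' e Uw'.
  by rewrite (e Uw').
- exists (~` (interior [set w | U w -> ~~ P w])).
    by apply: open_closedC; exact: open_interior.
  apply/seteqP; split => w [Uw].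
    by move=> Pw; split=> // /interior_subset /(_ Uw) /=; rewrite Pw.
  move=> nw; split=> //=; apply: contrapT => /negP nP; apply: nw.
  by apply: filterS (Ploc w Uw) => w' e Uw'; rewrite (e Uw').
Qed.

Section FiniteFamilies.
Variable R : realType.
Implicit Types (f : nat -> R) (m : nat) (P : nat -> Prop).

Lemma ex_argmin f m P : (exists2 k, (k < m)%N & P k) ->
  exists k, [/\ (k < m)%N, P k & forall j, (j < m)%N -> P j -> f k <= f j].
Proof.
elim: m => [[k]//|m IH [k km Pk]].
have [Pm|nPm] := pselect (P m); have [[h hm Ph]|nh] :=
    pselect (exists2 h, (h < m)%N & P h).
- have [j [jm Pj jmin]] := IH (ex_intro2 _ _ h hm Ph).
  have [jm'|jm'] := leP (f j) (f m).
    exists j; split=> // [|h']; first exact: ltnW.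
    by rewrite ltnS leq_eqVlt => /predU1P[->//|]; exact: jmin.
  exists m; split=> // h'; rewrite ltnS leq_eqVlt => /predU1P[->//|] h'm Ph'.
  by apply: le_trans (ltW jm') _; exact: jmin.
- exists m; split=> // h'; rewrite ltnS leq_eqVlt => /predU1P[->//|] h'm Ph'.
  by case: nh; exists h'.
- have [j [jm Pj jmin]] := IH (ex_intro2 _ _ h hm Ph).
  exists j; split=> // [|h']; first exact: ltnW.
  by rewrite ltnS leq_eqVlt => /predU1P[->//|]; exact: jmin.
- case: nh; exists k => //; move: km; rewrite ltnS leq_eqVlt.
  by case/predU1P => // e; rewrite e in Pk.
Qed.

Lemma ltr_ind f m P :
  (forall k, (k < m)%N -> (forall j, (j < m)%N -> f j < f k -> P j) -> P k) ->
  forall k, (k < m)%N -> P k.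
Proof.
move=> H k km; apply: contrapT => nPk.
have [j [jm nPj jmin]] :=
  @ex_argmin f m (fun k => ~ P k) (ex_intro2 _ _ k km nPk).
apply: nPj; apply: H => // h hm; rewrite ltNge => /negP hj.
by apply: contrapT => nPh; apply: hj; exact: jmin.
Qed.

(** Supplies the [v - e] of small-shift arguments: no value [f j] lies in [[u, v)]. *)
Lemma ex_just_below f m (c v : R) : c < v ->
  exists u, [/\ c < u, u < v & forall j, (j < m)%N -> f j < v -> f j < u].
Proof.
move=> cv; elim: m => [|m [u [cu uv H]]].
  by exists ((c + v) / 2); split=> //; lra.
have [fv|fv] := ltP (f m) v.
  exists ((Num.max u (f m) + v) / 2).
  have := le_max u u (f m); have := le_max (f m) u (f m).
  have : Num.max u (f m) < v by rewrite gt_max uv.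
  rewrite !lexx orbT /= => h1 h2 h3; split; [lra|lra|].
  move=> j; rewrite ltnS leq_eqVlt => /predU1P[-> _|jm /(H _ jm)]; lra.
exists u; split=> // j; rewrite ltnS leq_eqVlt => /predU1P[->|]; last exact: H.
by rewrite ltNge fv.
Qed.

Lemma ex_pos_lower_bound f m : (forall j, (j < m)%N -> 0 < f j) ->
  exists2 e, 0 < e & forall j, (j < m)%N -> e <= f j.
Proof.
elim: m => [_|m IH H]; first by exists 1.
have [|e e0 He] := IH; first by move=> j jm; apply: H; exact: ltnW.
have fm := H m (ltnSn m).
exists (Num.min e (f m)); first by rewrite lt_min e0.
move=> j; rewrite ltnS leq_eqVlt => /predU1P[->|/He jm].
  by rewrite ge_min lexx orbT.
by rewrite ge_min jm.
Qed.
End FiniteFamilies.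

Lemma ex_itv_common (R : realFieldType) (a b c d : R) :
  a < b -> c < d -> a < d -> c < b ->
  exists x, [/\ a < x, x < b, c < x & x < d].
Proof.
move=> ab cd ad cb; exists ((Num.max a c + Num.min b d) / 2).
by have [ac|ac] := leP a c; have [bd|bd] := leP b d; split; lra.
Qed.

Lemma continuous_horizontal_line (R : realType) (y : R) :
  continuous (fun c : R => (c, y)).
Proof.
move=> c; apply/cvg_ballP => e e0; apply/nbhs_ballP; exists e => //= c' bc.
by split=> //=; exact: ballxx.
Qed.

Lemma continuous_vertical_line (R : realType) (x : R) :
  continuous (fun c : R => (x, c)).
Proof.
move=> c; apply/cvg_ballP => e e0; apply/nbhs_ballP; exists e => //= c' bc.
by split=> //=; exact: ballxx.
Qed.

(** * Barriers formed by chains of touching squares, stated abstractly to serve both axes *)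

Section Barrier.
Variables (R : realType) (i : nat) (l r b t : nat -> R) (c : nat -> nat).
Variable F : R -> R -> Prop.
Hypothesis cP : forall k, (k < i)%N -> 0 < l k ->
  [/\ (c k < k)%N, r (c k) = l k, l (c k) < r (c k), b (c k) < t k
    & b k < t (c k)].
Hypothesis F_ge0 : forall x y, F x y -> 0 <= x.
Hypothesis F_free : forall x y k, F x y -> (k < i)%N -> l k <= x -> x <= r k ->
  (y < b k) || (t k < y).
Hypothesis bt : forall k, (k < i)%N -> b k < t k.

(* [(x, y)] with [x <= r k] is below the chain [k, c k, c (c k), ...], which
   meets every vertical line between [0] and [r k]; the fuel [n] is any number
   above [k]. *)
Fixpoint below (n k : nat) (x y : R) : bool :=
  if n is n'.+1 then
    if l k <= x then y < b k else below n' (c k) x y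
  else false.

Lemma below_single_locally_constant k x y :
  (k < i)%N -> F x y -> l k <= x -> x <= r k ->
  exists2 e, 0 < e & forall x' y', F x' y' -> `|y - y'| < e ->
    l k <= x' -> x' <= r k -> (y' < b k) = (y < b k).
Proof.
move=> ki Fxy lx xr; exists (t k - b k); first by rewrite subr_gt0 bt.
move=> x' y' Fxy' h lx' xr'.
have h1 := ler_norm (y - y'); have h2 := ler_norm (y' - y).
rewrite distrC in h2.
have /orP h3 := F_free Fxy ki lx xr; have /orP h4 := F_free Fxy' ki lx' xr'.
have btk := bt ki.
by case: h3 => h3; case: h4 => h4; apply/idP/idP => h5;
  clear -h h1 h2 h3 h4 h5 btk; lra.
Qed.

(** The delicate abscissa is [l k], where the test passes from [k] to [c k]. These squares overlap
    in height, so a free point on that line is below both or above both. *)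
Lemma below_locally_constant n k x y :
  (k < n)%N -> (k < i)%N -> F x y -> x <= r k ->
  exists2 e, 0 < e & forall x' y', F x' y' -> `|x - x'| < e -> `|y - y'| < e ->
    x' <= r k -> below n k x' y' = below n k x y.
Proof.
elim: n k => // n IH k kn ki Fxy xr /=.
have chain : 0 < l k -> x <= l k -> exists2 e, 0 < e &
    forall x' y', F x' y' -> `|x - x'| < e -> `|y - y'| < e ->
    x' <= l k -> below n (c k) x' y' = below n (c k) x y.
  move=> l0 xl; have [ck <- _ _ _] := cP ki l0.
  apply: IH => //; [exact: leq_trans ck _|exact: ltn_trans ck ki|].
  by have [_ ->] := cP ki l0.
have [lx|lx] := leP (l k) x; last first.
  have l0 : 0 < l k by apply: le_lt_trans lx; exact: F_ge0 Fxy.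
  have [e e0 He] := chain l0 (ltW lx).
  exists (Num.min e (l k - x)); first by rewrite lt_min e0 subr_gt0.
  move=> x' y' Fxy'; rewrite !lt_min => /andP[h1 h1'] /andP[h2 _] xr'.
  have lx' : x' < l k.
    by move: h1'; rewrite distrC => h; have := ler_norm (x' - x); lra.
  by rewrite leNgt lx' /=; apply: He => //; rewrite ltW.
have [e1 e10 He1] := below_single_locally_constant ki Fxy lx xr.
have [lx0|lx0] := ltP (l k) x.
  exists (Num.min e1 (x - l k)); first by rewrite lt_min e10 subr_gt0.
  move=> x' y' Fxy'; rewrite !lt_min => /andP[_ h1] /andP[h2 _] xr'.
  have lx' : l k <= x' by have := ler_norm (x - x'); lra.
  by rewrite lx'; exact: He1 Fxy' h2 lx' xr'.
have {}lx0 : x = l k by apply/le_anti/andP.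
subst x; have [l0|l0] := ltP 0 (l k); last first.
  exists e1 => // x' y' Fxy' _ h2 xr'.
  have lx' : l k <= x' by apply: le_trans l0 _; exact: F_ge0 Fxy'.
  by rewrite lx'; exact: He1 Fxy' h2 lx' xr'.
have [e e0 He] := chain l0 (lexx _).
exists (Num.min e e1); first by rewrite lt_min e0.
move=> x' y' Fxy'; rewrite !lt_min => /andP[h1 h1'] /andP[h2 h2'] xr'.
have [lx'|lx'] := leP (l k) x'; first exact: He1 Fxy' h2' lx' xr'.
rewrite He ?(ltW lx') //.
have [ck rc lc bt1 bt2] := cP ki l0.
case: (n) kn => [|n' _ /=]; first by case: (k) ck.
rewrite -{1}rc (ltW lc).
have h1'' := F_free Fxy ki lx xr.
have := F_free Fxy (ltn_trans ck ki); rewrite -rc lexx (ltW lc) => /(_ isT isT).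
by case/orP: h1'' => h; case/orP => h'; apply/idP/idP => h'';
  clear -h h' h'' bt1 bt2; lra.
Qed.

Lemma belowS n k x y : (k < n)%N ->
  below n k x y = if l k <= x then y < b k else below n.-1 (c k) x y.
Proof. by case: n. Qed.

Lemma below_bound n k (x y : R) : 0 <= x -> (k < i)%N -> below n k x y ->
  exists2 j, (j < i)%N & y < b j.
Proof.
move=> x0; elim: n k => // n IH k ki /=.
case: (leP (l k) x) => [_ yb|xl]; first by exists k.
move=> bel; apply: IH bel; have [ck _ _ _ _] := cP ki (le_lt_trans x0 xl).
exact: ltn_trans ck ki.
Qed.
End Barrier.

(** * Contacts in a bottom-left packing *)

Section Packing.
Variables (R : realType) (W : R) (s : nat -> R) (p : nat -> R * R) (i : nat).
Hypothesis s_gt0 : forall j, (j < i)%N -> 0 < s j.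
Hypothesis BL : BL_packing W s i p.

Local Notation l k := (p k).1.
Local Notation b k := (p k).2.
Local Notation r k := ((p k).1 + s k).
Local Notation t k := ((p k).2 + s k).

Lemma square_in_strip k : (k < i)%N -> [/\ 0 <= l k, r k <= W & 0 <= b k].
Proof.
move=> ki; have sk := s_gt0 ki; have [[sub _] _] := BL ki.
have := sub (p k); have := sub (r k, t k).
rewrite /csquare /strip /= !lexx !lerDl (ltW sk) /=.
by move=> [] // /andP[_ rW] _ [] // /andP[-> _] ->.
Qed.

Lemma squares_separated j k : (j < i)%N -> (k < i)%N -> j <> k ->
  [\/ r j <= l k, r k <= l j, t j <= b k | t k <= b j].
Proof.
wlog jk : j k / (j < k)%N.
  move=> H ji ki jk; have [jk'|kj|//] := ltngtP j k; first exact: H.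
  by have [] := H _ _ kj ki ji (nesym jk);
    [constructor 2|constructor 1|constructor 4|constructor 3].
move=> ji ki _; have [[_ /(_ j jk) disj] _] := BL ki.
have sj := s_gt0 ji; have sk := s_gt0 ki.
have [?|h1] := leP (r j) (l k); first by constructor 1.
have [?|h2] := leP (r k) (l j); first by constructor 2.
have [?|h3] := leP (t j) (b k); first by constructor 3.
have [?|h4] := leP (t k) (b j); first by constructor 4.
exfalso; have [||||x [xj1 xj2 xk1 xk2]] :=
  @ex_itv_common R (l j) (r j) (l k) (r k); rewrite ?ltrDl //.
have [||||y [yj1 yj2 yk1 yk2]] :=
  @ex_itv_common R (b j) (t j) (b k) (t k); rewrite ?ltrDl //.
suff : set0 (x, y) by [].
by rewrite -disj /osquare /=; split; split; apply/andP; split.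
Qed.

Lemma separated_right j k : (j < i)%N -> (k < i)%N -> j <> k ->
  b j < t k -> b k < t j -> l j < r k -> r j <= l k.
Proof.
move=> ji ki jk h1 h2 h3.
by have [//|h|h|h] := squares_separated ji ki jk; exfalso;
  clear -h h1 h2 h3; lra.
Qed.

(** Contradiction scheme for minimality: the corner [(x, u)] is feasible once no earlier square
    shares an interior point [(a, c)] with the square placed there. *)
Lemma BL_minimal k x u : (k < i)%N -> 0 <= x -> x + s k <= W -> 0 <= u ->
  (forall j a c, (j < k)%N -> x < a -> a < x + s k -> u < c -> c < u + s k ->
    l j < a -> a < r j -> b j < c -> c < t j -> False) ->
  b k < u \/ b k = u /\ l k <= x.
Proof.
move=> ki x0 xW u0 nov; have [_ /(_ (x, u))] := BL ki; apply; split.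
  move=> z [/andP[/= h1 h2] /andP[h3 h4]]; split; last exact: le_trans h3.
  by rewrite (le_trans x0 h1) (le_trans h2 xW).
move=> j jk; apply/seteqP; split => // z.
move=> [[/andP[/= h1 h2] /andP[h3 h4]] [/andP[/= h5 h6] /andP[h7 h8]]].
exact: (nov j z.1 z.2).
Qed.

(** Without a support, [k] could sink to a height [u] that is still above every top lying below
    [b k]. *)
Lemma bottom_contact k : (k < i)%N -> 0 < b k ->
  exists j, [/\ (j < k)%N, t j = b k, l j < r k & l k < r j].
Proof.
move=> ki b0; apply: contrapT => nj.
have [u [u0 ub uH]] := ex_just_below (fun j => t j) k b0.
have [l0 rW _] := square_in_strip ki.
have sk := s_gt0 ki.
have [||] := BL_minimal ki l0 rW (ltW u0); [|lra|by move=> []; lra].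
move=> j a c jk h1 h2 h3 h4 h5 h6 h7 h8.
have ji := ltn_trans jk ki; have sj := s_gt0 ji.
have [|||tj|?] := squares_separated ji ki; [|lra|lra| |lra].
  by move=> e; rewrite e ltnn in jk.
have [tjb|tjb] := ltP (t j) (b k); first by have := uH j jk tjb; lra.
by apply: nj; exists j; split=> //; lra.
Qed.

Lemma left_contact k : (k < i)%N -> 0 < l k ->
  exists j, [/\ (j < k)%N, r j = l k, b j < t k & b k < t j].
Proof.
move=> ki b0; apply: contrapT => nj.
have [u [u0 ub uH]] := ex_just_below (fun j => r j) k b0.
have [l0 rW b0'] := square_in_strip ki.
have sk := s_gt0 ki; have uW : u + s k <= W by lra.
have [||] := BL_minimal ki (ltW u0) uW b0'; [|lra|by move=> []; lra].
move=> j a c jk h1 h2 h3 h4 h5 h6 h7 h8.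
have ji := ltn_trans jk ki; have sj := s_gt0 ji.
have [|rj|||] := squares_separated ji ki; [| |lra|lra|lra].
  by move=> e; rewrite e ltnn in jk.
have [rjb|rjb] := ltP (r j) (l k); first by have := uH j jk rjb; lra.
by apply: nj; exists j; split=> //; lra.
Qed.

Lemma ex_contacts : exists dn lf : nat -> nat,
  (forall k, (k < i)%N -> 0 < b k ->
    [/\ (dn k < k)%N, t (dn k) = b k, l (dn k) < r k & l k < r (dn k)]) /\
  (forall k, (k < i)%N -> 0 < l k ->
    [/\ (lf k < k)%N, r (lf k) = l k, b (lf k) < t k & b k < t (lf k)]).
Proof.
have [dn dnP] : {dn : nat -> nat & forall k, (k < i)%N -> 0 < b k ->
    [/\ (dn k < k)%N, t (dn k) = b k, l (dn k) < r k & l k < r (dn k)]}.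
  apply: (@choice _ _ (fun k j => (k < i)%N -> 0 < b k ->
    [/\ (j < k)%N, t j = b k, l j < r k & l k < r j])) => k.
  have [[ki b0]|nk] := pselect ((k < i)%N /\ 0 < b k).
    by have [j] := bottom_contact ki b0; exists j.
  (* [0] is a dummy value, for squares on the floor and indices outside the packing. *)
  by exists 0 => ki b0; case: nk.
have [lf lfP] : {lf : nat -> nat & forall k, (k < i)%N -> 0 < l k ->
    [/\ (lf k < k)%N, r (lf k) = l k, b (lf k) < t k & b k < t (lf k)]}.
  apply: (@choice _ _ (fun k j => (k < i)%N -> 0 < l k ->
    [/\ (j < k)%N, r j = l k, b j < t k & b k < t j])) => k.
  have [[ki b0]|nk] := pselect ((k < i)%N /\ 0 < l k).
    by have [j] := left_contact ki b0; exists j.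
  by exists 0 => ki b0; case: nk.
by exists dn, lf.
Qed.

(** * Free space and the corner region of a square *)

Definition free (x y : R) : Prop :=
  [/\ 0 <= x, x <= W, 0 <= y & forall k, (k < i)%N ->
    ~ [/\ l k <= x, x <= r k, b k <= y & y <= t k]].

Definition translates (k : nat) : seq (R * R) :=
  [:: (r k, b k); (l k, b k - s k); (r k, b k - s k); (r k + s k, b k - s k)].

Lemma freeE (z : R * R) :
  (strip W `\` \bigcup_(j in [set j | (j < i)%N]) Sq s p j) z = free z.1 z.2.
Proof.
apply/propext; split.
  move=> [[/andP[x0 xW] y0] nS]; split=> // k ki [h1 h2 h3 h4]; apply: nS.
  by exists k => //; split; apply/andP.
move=> [x0 xW y0 nS]; split; first by split=> //; apply/andP.
by move=> [k ki [/andP[h1 h2] /andP[h3 h4]]]; apply: (nS k ki).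
Qed.

Lemma free_vertical x y k : free x y -> (k < i)%N -> l k <= x -> x <= r k ->
  (y < b k) || (t k < y).
Proof.
move=> [_ _ _ h] ki lx xr; rewrite !ltNge -negb_and; apply/andP => -[h1 h2].
exact: (h k ki).
Qed.

Lemma free_horizontal x y k : free x y -> (k < i)%N -> b k <= y -> y <= t k ->
  (x < l k) || (r k < x).
Proof.
move=> [_ _ _ h] ki lx xr; rewrite !ltNge -negb_and; apply/andP => -[h1 h2].
exact: (h k ki).
Qed.

Variables dn lf : nat -> nat.
Hypothesis dnP : forall k, (k < i)%N -> 0 < b k ->
  [/\ (dn k < k)%N, t (dn k) = b k, l (dn k) < r k & l k < r (dn k)].
Hypothesis lfP : forall k, (k < i)%N -> 0 < l k ->
  [/\ (lf k < k)%N, r (lf k) = l k, b (lf k) < t k & b k < t (lf k)].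

Definition left_below n k x y :=
  below (fun k => l k) (fun k => b k) lf n k x y.
(** [below] with the coordinates exchanged: the point is to the left of the chain of supports. *)
Definition down_left n k x y :=
  below (fun k => b k) (fun k => l k) dn n k y x.

(* The region cut off by the chain of left contacts of [k], which leads to the
   left wall, and its chain of supports, which leads to the floor. *)
Definition cornered (k : nat) (x y : R) : bool :=
  [&& (x <= r k) || (y <= t k), (x <= r k) ==> left_below i k x y &
      (y <= t k) ==> down_left i k x y].

Lemma lf_chain k : (k < i)%N -> 0 < l k ->
  [/\ (lf k < k)%N, r (lf k) = l k, l (lf k) < r (lf k), b (lf k) < t k
    & b k < t (lf k)].
Proof.
move=> ki l0; have [? ? ? ?] := lfP ki l0; split=> //.
by rewrite ltrDl s_gt0 // (ltn_trans _ ki).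
Qed.

(** Both chain tests are locally constant; what remains is crossing the lines [x = r k] and
    [y = t k], where one test is switched on or off. *)
Lemma cornered_locally_constant k x y : (k < i)%N -> free x y ->
  exists2 e, 0 < e & forall x' y', free x' y' -> `|x - x'| < e ->
    `|y - y'| < e -> cornered k x' y' = cornered k x y.
Proof.
move=> ki Fxy.
have [eL eL0 HL] : exists2 e, 0 < e & forall x' y', free x' y' ->
    `|x - x'| < e -> `|y - y'| < e -> x <= r k -> x' <= r k ->
    left_below i k x' y' = left_below i k x y.
  have [xr|xr] := leP x (r k); last by exists 1 => // *; lra.
  have [||||||||e e0 He] := @below_locally_constant R i (fun k => l k)
    (fun k => r k) (fun k => b k) (fun k => t k) lf free _ _ _ _ i k x y => //.
  - exact: lf_chain.
  - by move=> ? ? [].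
  - by move=> ? ? ? h1 h2 h3 h4; exact: free_vertical h1 h2 h3 h4.
  - by move=> j ji; rewrite ltrDl s_gt0.
  by exists e => // x' y' F' h1 h2 _; exact: He.
have [eD eD0 HD] : exists2 e, 0 < e & forall x' y', free x' y' ->
    `|x - x'| < e -> `|y - y'| < e -> y <= t k -> y' <= t k ->
    down_left i k x' y' = down_left i k x y.
  have [yt|yt] := leP y (t k); last by exists 1 => // *; lra.
  have [||||||||e e0 He] := @below_locally_constant R i (fun k => b k)
    (fun k => t k) (fun k => l k) (fun k => r k) dn (fun y x => free x y)
    _ _ _ _ i k y x => //.
  - move=> j ji b0; have [? ? ? ?] := dnP ji b0; split=> //.
    by rewrite ltrDl s_gt0 // (ltn_trans _ ji).
  - by move=> ? ? [].
  - by move=> ? ? ? h1 h2 h3 h4; exact: free_horizontal h1 h2 h3 h4.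
  - by move=> j ji; rewrite ltrDl s_gt0.
  by exists e => // x' y' F' h1 h2 _; exact: He.
have [ex ex0 Hx] : exists2 e, 0 < e & forall x', `|x - x'| < e ->
    (x < r k -> x' < r k) /\ (r k < x -> r k < x').
  have [xr|xr|xr] := ltgtP x (r k); last by exists 1.
    exists (r k - x); first by rewrite subr_gt0.
    move=> x'; rewrite distrC => h; have := ler_norm (x' - x).
    by split=> //; lra.
  exists (x - r k); first by rewrite subr_gt0.
  by move=> x' h; have := ler_norm (x - x'); split=> //; lra.
have [ey ey0 Hy] : exists2 e, 0 < e & forall y', `|y - y'| < e ->
    (y < t k -> y' < t k) /\ (t k < y -> t k < y').
  have [yt|yt|yt] := ltgtP y (t k); last by exists 1.
    exists (t k - y); first by rewrite subr_gt0.
    move=> y'; rewrite distrC => h; have := ler_norm (y' - y).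
    by split=> //; lra.
  exists (y - t k); first by rewrite subr_gt0.
  by move=> y' h; have := ler_norm (y - y'); split=> //; lra.
exists (Num.min (Num.min eL eD) (Num.min ex ey)).
  by rewrite !lt_min eL0 eD0 ex0.
move=> x' y' F'; rewrite !lt_min => /andP[/andP[xL xD] /andP[xx _]].
move=> /andP[/andP[yL yD] /andP[_ yy]].
have {}HL := HL x' y' F' xL yL; have {}HD := HD x' y' F' xD yD.
have [{}Hx Hx'] := Hx x' xx; have [{}Hy Hy'] := Hy y' yy.
have sk := s_gt0 ki.
(* On [x = r k] the left test is just [y < b k]. If it holds, dropping it changes nothing; if it
   fails, then [t k < y] and neither side of the line is cornered. The line [y = t k] is
   symmetric. *)
have Lr : x = r k -> left_below i k x y = (y < b k).
  by move=> xr; rewrite /left_below belowS // xr lerDl ltW.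
have Dt : y = t k -> down_left i k x y = (x < l k).
  by move=> yt; rewrite /down_left belowS // yt lerDl ltW.
have Fv := free_vertical Fxy ki; have Fh := free_horizontal Fxy ki.
rewrite /cornered.
have [xr|xr|xr] := ltgtP x (r k); have [yt|yt|yt] := ltgtP y (t k) => /=.
- by rewrite (ltW (Hx xr)) (ltW (Hy yt)) /= HL ?HD // ltW // ?Hx ?Hy.
- rewrite (ltW (Hx xr)) [y' <= _]leNgt (Hy' yt) /= HL //; first exact: ltW.
  by rewrite ltW // Hx.
- rewrite (ltW (Hx xr)) /= HL //; [|exact: ltW|by rewrite ltW // Hx].
  have xl : x < l k.
    by move: Fh; rewrite yt lexx lerDl (ltW sk) => /(_ isT isT) /orP[//|]; lra.
  rewrite Dt // xl; case: leP => //= y't; rewrite HD ?yt ?lexx // -yt Dt // xl.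
  by [].
- rewrite (ltW (Hy yt)) orbT [x' <= _]leNgt (Hx' xr) /= HD //; first exact: ltW.
  by rewrite ltW // Hy.
- by rewrite !leNgt (Hx' xr) (Hy' yt).
- rewrite [x' <= _]leNgt (Hx' xr) /= Dt //.
  have -> : (x < l k) = false by apply/negbTE; rewrite -leNgt; lra.
  case: leP => //= y't; rewrite HD ?yt ?lexx // -yt Dt //.
  by apply/negbTE; rewrite -leNgt; lra.
- have yb : y < b k.
    by move: Fv; rewrite xr lexx lerDl (ltW sk) => /(_ isT isT) /orP[//|]; lra.
  rewrite (ltW (Hy yt)) orbT /= HD //; [|exact: ltW|by rewrite ltW // Hy].
  rewrite Lr // yb; case: leP => //= x'r; rewrite HL ?xr ?lexx // -xr Lr // yb.
  by [].
- rewrite [y' <= _]leNgt (Hy' yt) /= Lr //.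
  have -> : (y < b k) = false by apply/negbTE; rewrite -leNgt; lra.
  case: leP => //= x'r; rewrite HL ?xr ?lexx // -xr Lr //.
  by rewrite andbT; apply/negbTE; rewrite -leNgt; lra.
- by move: Fv; rewrite xr yt !lexx !lerDl (ltW sk) => /(_ isT isT) /orP[|]; lra.
Qed.

(** Keeps cornered points off the right wall: square [j] lies in the strip, so its side bounds the
    distance to the wall from below. *)
Lemma cornered_left_of_square k x y : (k < i)%N -> free x y ->
  cornered k x y -> exists2 j, (j < i)%N & x < l j.
Proof.
move=> ki Fxy /and3P[h1 h2 h3]; have [x0 _ y0 _] := Fxy.
have [yt|yt] := leP y (t k).
  move: h3; rewrite yt /=.
  apply: (@below_bound R i _ (fun k => t k) _ (fun k => r k)) => //.
  move=> j ji b0; have [? ? ? ?] := dnP ji b0; split=> //.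
  by rewrite ltrDl s_gt0 // (ltn_trans _ ji).
move: h1 h2; rewrite [y <= _]leNgt yt orbF => -> /=.
rewrite /left_below belowS //; case: (leP (l k) x) => [_ yb|]; last by exists k.
by have := s_gt0 ki; lra.
Qed.

(** * The component [U] of free space that reaches the right wall *)

Variable U : set (R * R).
Hypothesis U_connected : connected U.
Hypothesis U_free : forall z, U z -> free z.1 z.2.
Hypothesis U_absorbs : forall C : set (R * R), connected C ->
  (forall z, C z -> free z.1 z.2) -> C `&` U !=set0 -> C `<=` U.
Hypothesis U_bounded : Defs.bounded_set U.
Hypothesis U_right : right_piece W U.

(** By connectedness one cornered point makes all of [U] cornered, hence at least the smallest side
    away from the right wall, which the closure of [U] meets. *)
Lemma not_cornered k x y : (k < i)%N -> U (x, y) -> ~~ cornered k x y.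
Proof.
move=> ki Uxy; apply/negP => cxy.
have cU z : U z -> cornered k z.1 z.2.
  move=> Uz.
  apply: (@connected_locally_constant _ U (fun z => cornered k z.1 z.2)
            U_connected _ (x, y) z) => //.
  move=> w Uw; have [e e0 He] := cornered_locally_constant ki (U_free Uw).
  apply/nbhs_ballP; exists e => //= w' [b1 b2] Uw'.
  by apply: He => //; exact: U_free Uw'.
have [e e0 He] := ex_pos_lower_bound s_gt0.
have [[x1 y1] [/= cl [/= xW _]]] := U_right.
have [|w [Uw [/= b1 _]]] := cl (ball (x1, y1) e); first exact: nbhsx_ballx.
have [j ji wj] := cornered_left_of_square ki (U_free Uw) (cU w Uw).
have [_ rW _] := square_in_strip ji.
have := He j ji; move: b1; rewrite /ball /= => b1.
by have := ler_norm (x1 - w.1); lra.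
Qed.

(** Directly under [k] the left test holds outright, so the support test must be the one that
    fails. *)
Lemma chain_under_square k x y : (k < i)%N -> U (x, y) -> l k <= x ->
  x <= r k -> y < b k -> ~~ down_left i k x y.
Proof.
move=> ki Uxy lx xr yb; apply/negP => D.
have /negP := not_cornered ki Uxy; apply.
rewrite /cornered xr D implybT /= andbT /left_below belowS // lx.
by rewrite yb.
Qed.

Lemma path_in_U (f : R -> R * R) (c d e1 e2 : R) : continuous f ->
  (forall a, c <= a -> a <= d -> free (f a).1 (f a).2) ->
  c <= e1 -> e1 <= d -> c <= e2 -> e2 <= d -> U (f e1) -> U (f e2).
Proof.
move=> fc fF ce1 e1d ce2 e2d Ue1.
apply: (U_absorbs (C := f @` `[c, d])).
- apply: connected_continuous_connected; first exact: segment_connected.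
  exact: continuous_subspaceT.
- by move=> z [a]; rewrite /= in_itv /= => /andP[ca ad] <-; exact: fF.
- by exists (f e1); split=> //; exists e1 => //=; rewrite in_itv /= ce1.
- by exists e2 => //=; rewrite in_itv /= ce2.
Qed.

Lemma row_in_U u x a : U (x, u) -> a <= x ->
  (forall c, a <= c -> c <= x -> free c u) -> U (a, u).
Proof.
move=> Ux ax aF; apply: (@path_in_U (fun c => (c, u)) a x x a) => //.
exact: continuous_horizontal_line.
Qed.

Lemma column_in_U x u v : U (x, u) -> u <= v ->
  (forall c, u <= c -> c <= v -> free x c) -> U (x, v).
Proof.
move=> Ux ax aF; apply: (@path_in_U (fun c => (x, c)) u v u v) => //.
exact: continuous_vertical_line.
Qed.

(** With no square above, the vertical ray from [(x, y)] would lie in the bounded set [U]. *)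
Lemma ex_square_above x y : U (x, y) -> exists A,
  [/\ (A < i)%N, l A <= x, x <= r A, y < b A &
      forall u, y <= u -> u < b A -> U (x, u)].
Proof.
move=> Uxy; have [x0 xW y0 Fxy] := U_free Uxy.
have col v : y <= v -> (forall k, (k < i)%N -> l k <= x -> x <= r k ->
    y < b k -> v < b k) -> U (x, v).
  move=> yv H; apply: column_in_U Uxy yv _ => c yc cv; split=> //.
    exact: le_trans yc.
  move=> k ki [h1 h2 h3 h4]; have [yb|yb] := ltP y (b k).
    by have := H k ki h1 h2 yb; rewrite ltNge (le_trans h3 cv).
  by apply: (Fxy k ki); split=> //; exact: le_trans yc h4.
have [|A [Ai [lA rA yA] Amin]] := @ex_argmin R (fun k => b k) i
    (fun k => [/\ l k <= x, x <= r k & y < b k]).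
  apply: contrapT => nk; have [M HM] := U_bounded.
  have yv : y <= Num.max y (M + 1) by rewrite le_max lexx.
  have /HM [_ /=] : U (x, Num.max y (M + 1)).
    by apply: col => // k ki h1 h2 h3; case: nk; exists k.
  have h1 := ler_norm (Num.max y (M + 1)).
  have h2 : M + 1 <= Num.max y (M + 1) by rewrite le_max lexx orbT.
  by lra.
exists A; split=> // u yu uA; apply: col => // k ki h1 h2 h3.
by apply: lt_le_trans uA _; exact: Amin.
Qed.

(** * The view to the left from a vertical arm in [U] *)

Section Point.
Variables (x y : R) (A : nat).
Hypotheses (Ai : (A < i)%N) (lA : l A <= x) (rA : x <= r A) (yA : y < b A).
Hypothesis arm : forall u, y <= u -> u < b A -> U (x, u).

(* The squares met by horizontal lines slightly below height [v], to the left of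
   the vertical segment from [(x, y)] up to [A]. *)
Definition straddles v k := [/\ (k < i)%N, b k < v, v <= t k & r k < x].

Definition rightmost v k :=
  straddles v k /\ forall m, straddles v m -> r m <= r k.

(* [k] lies in part above free space: no square supporting its bottom edge
   reaches as far right as [k] itself. *)
Definition overhang k := [/\ (k < i)%N, y < b k, b k <= b A, l k <= x &
  forall m, straddles (b k) m -> r m < r k].

(* [u] is below [v], with no horizontal edge of a square in between. *)
Definition level v u := [/\ y < u, u < v & forall k, (k < i)%N ->
  (b k < v -> b k < u) /\ (t k < v -> t k < u)].

Let x_leW : x <= W. Proof. by have [] := U_free (arm (lexx y) yA). Qed.
Let y_ge0 : 0 <= y. Proof. by have [] := U_free (arm (lexx y) yA). Qed.

Lemma left_of_arm u k : (k < i)%N -> y <= u -> u < b A -> b k <= u ->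
  u <= t k -> l k <= x -> r k < x.
Proof.
move=> ki yu uA bu ut lx.
have := free_horizontal (U_free (arm yu uA)) ki bu ut => /=.
by rewrite ltNge lx.
Qed.

Lemma ex_level_above c v : y <= c -> c < v -> exists2 u, level v u & c < u.
Proof.
move=> yc cv; have [u1 [cu1 u1v H1]] := ex_just_below (fun k => b k) i cv.
have [u [u1u uv H2]] := ex_just_below (fun k => t k) i u1v.
exists u; last exact: lt_trans u1u.
split=> //; first by apply: le_lt_trans yc _; exact: lt_trans u1u.
move=> k ki; split; last exact: H2.
by move=> bv; apply: lt_trans u1u; exact: H1.
Qed.

Lemma ex_level v : y < v -> exists u, level v u.
Proof. by move=> /(ex_level_above (lexx y)) [u vu _]; exists u. Qed.

Lemma straddles_level v u k : v <= b A -> level v u -> (k < i)%N -> l k <= x ->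
  b k < v -> u <= t k -> straddles v k.
Proof.
move=> vA [yu uv H] ki lx bv ut; have [Hb Ht] := H k ki; split=> //.
  by rewrite leNgt; apply/negP => /Ht; rewrite ltNge ut.
apply: (@left_of_arm u) => //; first exact: ltW.
  exact: lt_le_trans vA.
by rewrite ltW ?Hb.
Qed.

(** A square meeting the row between [a] and the arm would straddle [v] and reach [a]. *)
Lemma row_to_arm v u a : v <= b A -> level v u -> 0 <= a -> a <= x ->
  (forall m, straddles v m -> r m < a) -> U (a, u).
Proof.
move=> vA vu a0 ax Ha; have [yu uv _] := vu.
apply: row_in_U ax _; first by apply: arm; [exact: ltW|exact: lt_le_trans vA].
move=> c ac cx; split.
- exact: le_trans ac.
- exact: le_trans x_leW.
- by rewrite (le_trans y_ge0) // ltW.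
move=> k ki [lc cr bu ut].
have : straddles v k.
  apply: straddles_level vu ki _ _ ut => //; first exact: le_trans cx.
  exact: le_lt_trans uv.
by move=> /Ha; rewrite ltNge (le_trans ac cr).
Qed.

Lemma overhang_above : overhang A.
Proof. by split=> // m [_ _ _ rx]; exact: lt_le_trans rA. Qed.

(** * The lowest overhang [j] and the visible squares below it *)

Variable j : nat.
Hypothesis jO : overhang j.
Hypothesis jmin : forall k, overhang k -> b j <= b k.

Let ji : (j < i)%N. Proof. by case: jO. Qed.
Let yj : y < b j. Proof. by case: jO. Qed.
Let jA : b j <= b A. Proof. by case: jO. Qed.
Let lj : l j <= x. Proof. by case: jO. Qed.

(** A straddling square whose bottom is at least [v'] starts below [j], hence is no overhang: some
    square straddling its bottom reaches as far right. Descend by induction on the bottom. *)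
Lemma straddles_descend v v' k : y < v' -> v' <= v -> v <= b j ->
  straddles v k -> exists2 m, straddles v' m & r k <= r m.
Proof.
move=> yv' v'v vj vk; have ki : (k < i)%N by case: vk.
move: v v'v vj vk; move: k ki; apply: (@ltr_ind R (fun k => b k)).
move=> k ki IH v v'v vj [_ bv vt rx].
have [bv'|bv'] := ltP (b k) v'; first by exists k => //; split=> //; lra.
have bj : b k < b j by exact: lt_le_trans vj.
have jA' := jA.
have [m [mk rm]] : exists m, straddles (b k) m /\ r k <= r m.
  apply: contrapT => nm; have := bj; rewrite ltNge => /negP; apply; apply: jmin.
  split=> //; [exact: lt_le_trans bv'|by lra|by have := s_gt0 ki; lra|].
  by move=> m mk; rewrite ltNge; apply/negP => rm; apply: nm; exists m.
have [mi bm _ _] := mk.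
have [m' m'v rm'] := IH m mi bm (b k) bv' (ltW bj) mk.
by exists m' => //; exact: le_trans rm'.
Qed.

(** Abscissa on the bottom edge of [j], right of all squares straddling [b j] but not beyond the
    arm. *)
Let xj := Num.min x (r j).

Let overhang_abscissa : [/\ xj <= x, xj <= r j & l j <= xj].
Proof.
have sj := s_gt0 ji.
by split; rewrite ?ge_min ?le_min ?lexx ?orbT // lj lerDl ltW.
Qed.

Lemma below_overhang u : level (b j) u -> U (xj, u).
Proof.
move=> vu; have [ax _ la] := overhang_abscissa.
have [l0 _ _] := square_in_strip ji.
apply: row_to_arm vu _ ax _ => //; first exact: le_trans la.
move=> m mj; rewrite lt_min; case: jO => _ _ _ _ /(_ m mj) ->.
by case: mj => _ _ _ ->.
Qed.

(** If [dn j] began to the right of the arm, the point of [U] just under [j] at [xj] would be left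
    of the support chain, against [chain_under_square]. *)
Lemma support_straddles : straddles (b j) (dn j) /\ l j < r (dn j).
Proof.
have bj0 : 0 < b j by exact: le_lt_trans yj.
have [dj tb lr rl] := dnP ji bj0; split=> //.
have di := ltn_trans dj ji.
have [u vu] := ex_level yj; have [yu uv H] := vu.
have sj := s_gt0 ji; have sd := s_gt0 di.
have [ax aj la] := overhang_abscissa; have Ua := below_overhang vu.
have := chain_under_square ji Ua la aj uv.
rewrite /down_left belowS // leNgt uv /= => /negP nD.
have [Hb _] := H _ di; have bd : b (dn j) < u by apply: Hb; lra.
apply: straddles_level vu di _ _ _ => //; [|lra|lra].
rewrite leNgt; apply/negP => xd; apply: nD.
(* One unit of fuel went to [j]; [dn j < j < i] leaves enough. *)
have n0 : (dn j < i.-1)%N.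
  by case: (i) ji => // i'; rewrite ltnS; exact: leq_trans.
by rewrite belowS // ltW //; exact: le_lt_trans xd.
Qed.

(** Descending from [dn j] yields a straddling square at every height, so the view never reaches the
    left wall. *)
Lemma ex_rightmost v : y < v -> v <= b j -> exists k, rightmost v k.
Proof.
move=> yv vj; have [dj _] := support_straddles.
have [m mv _] := straddles_descend yv vj (lexx _) dj.
have [|k [ki kv kmax]] := @ex_argmin R (fun k => - r k) i (straddles v).
  by exists m => //; case: mv.
exists k; split=> // m' m'v; rewrite -lerN2; apply: kmax => //.
by case: m'v.
Qed.

Lemma rightmost_anti v v' k k' : y < v' -> v' <= v -> v <= b j ->
  rightmost v' k' -> straddles v k -> r k <= r k'.
Proof.
move=> yv' v'v vj [_ kmax] /(straddles_descend yv' v'v vj) [m mv' rm].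
by apply: le_trans rm _; exact: kmax.
Qed.

(** A visible [k] reaches at least as far as [dn j], hence past [l j], and stops before [r j];
    rising above [b j] it would overlap [j]. *)
Lemma rightmost_top_le v k : y < v -> v <= b j -> rightmost v k -> t k <= b j.
Proof.
move=> yv vj vk; rewrite leNgt; apply/negP => jt.
have [[ki bv vt rx] _] := vk; have [dj ld] := support_straddles.
have sj := s_gt0 ji; have sk := s_gt0 ki.
have kj : r k < r j.
  by case: jO => _ _ _ _; apply; split=> //; [exact: lt_le_trans vj|exact: ltW].
have rd := rightmost_anti yv vj (lexx _) vk dj.
have jk : j <> k by move=> e; rewrite e ltxx in kj.
have := separated_right ji ki jk jt; lra.
Qed.

(* Otherwise [k] would fit at [(r k1, b k - e)] for small [e]. *)
Lemma lower_square_wide v k k1 : y < b k -> v <= b j -> rightmost v k ->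
  rightmost (b k) k1 -> x - r k1 < s k.
Proof.
move=> yb vj vk bk; rewrite ltNge; apply/negP => sx.
have [[ki bv vt rx] _] := vk; have yv := lt_trans yb bv.
have jA' := jA; have tj := rightmost_top_le yv vj vk.
have bj := lt_le_trans bv vj.
have [[k1i bk1 tk1 rk1] k1max] := bk.
have [l0 _ _] := square_in_strip k1i; have sk1 := s_gt0 k1i.
have [u vu] := ex_level yb; have [yu ub H] := vu.
have h1 : 0 <= r k1 by lra.
have h2 : r k1 + s k <= W by have := x_leW; lra.
have h3 : 0 <= u by exact: le_trans (ltW yu).
have [||] := BL_minimal ki h1 h2 h3;
  [|by lra|by case=> e _; lra].
move=> m a c mk a1 a2 c1 c2 ma1 ma2 mc1 mc2.
have mi := ltn_trans mk ki.
(* The obstacle [m] reaches past [r k1]. It straddles [b k] if it starts below that height, and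
   otherwise [c], which is under [b j] by [tj]; both contradict the choice of [k1]. *)
have [bm|bm] := ltP (b m) (b k).
  have /k1max : straddles (b k) m.
    apply: straddles_level vu mi _ bm _.
    - by lra.
    - by lra.
    - by lra.
  by lra.
have cj : c < b j by lra.
have bc : b k <= c by lra.
have mc : straddles c m.
  split=> //; first exact: ltW.
  apply: (@left_of_arm c) => //; [|exact: lt_le_trans jA'|exact: ltW..|].
    by lra.
  by lra.
have := rightmost_anti yb bc (ltW cj) bk mc.
by lra.
Qed.

(* The chain of supports of a square beside [j], on its right, stays to the
   right of [j] until it drops below the bottom of [j]; there it would straddle
   the level of [j] unless it were to the right of [c]. *)
Lemma chain_right_of_overhang k1 u c n m : rightmost (b j) k1 ->
  level (b j) u -> c <= x -> (m < n)%N -> (m < i)%N -> b j <= b m ->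
  b m < t j -> r j <= l m -> down_left n m c u.
Proof.
move=> [[k1i bk1 tk1 rk1] k1max] vu cx; have [yu ub H] := vu.
have jk1 : r k1 < r j by case: jO => _ _ _ _; apply; split.
have sj := s_gt0 ji.
elim: n m => // n IH m mn mi bm tm lm.
rewrite /down_left /= leNgt (lt_le_trans ub bm) /=.
have [] := dnP mi; first by exact: lt_le_trans (le_lt_trans y_ge0 yj) _.
move=> dm td ldr rdl; have di := ltn_trans dm mi; have sd := s_gt0 di.
have dmn : (dn m < n)%N by exact: leq_trans dm _.
have [bd|bd] := ltP (b (dn m)) (b j).
  have [Hb _] := H _ di; rewrite belowS // ltW ?Hb // ltNge; apply/negP => lda.
  have /k1max : straddles (b j) (dn m).
    apply: straddles_level vu di _ bd _ => //; first by lra.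
    by lra.
  by lra.
apply: IH => //; first by lra.
apply: separated_right => //.
- by move=> e; rewrite -e in rdl; lra.
- by lra.
- by lra.
- by lra.
Qed.

(* Otherwise [j] would fit at [(r k1, b j - e)] for small [e]. *)
Lemma overhang_wide k1 : rightmost (b j) k1 -> x - r k1 < s j.
Proof.
move=> bk; rewrite ltNge; apply/negP => sx.
have [[k1i bk1 tk1 rk1] k1max] := bk.
have [l0 _ _] := square_in_strip k1i; have sk1 := s_gt0 k1i.
have [u vu] := ex_level yj; have [yu ub H] := vu.
have sj := s_gt0 ji.
have jk1 : r k1 < r j by case: jO => _ _ _ _; apply; split.
have [dj ld] := support_straddles; have rd := k1max _ dj.
have h1 : 0 <= r k1 by lra.
have h2 : r k1 + s j <= W by have := x_leW; lra.
have h3 : 0 <= u by exact: le_trans (ltW yu).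
have [||] := BL_minimal ji h1 h2 h3;
  [|by lra|by case=> e _; lra].
move=> m a c mj a1 a2 c1 c2 ma1 ma2 mc1 mc2.
have mi := ltn_trans mj ji.
have [bm|bm] := ltP (b m) (b j).
  have /k1max : straddles (b j) m.
    apply: straddles_level vu mi _ bm _ => //; first by lra.
    by lra.
  by lra.
(* Here [m] starts no lower than [j], so it lies to the right of [j]; the point [(a, u)] of [U]
   under [m] then falls left of the support chain of [m]. *)
have ax : a <= x by lra.
have Ua : U (a, u).
  apply: row_to_arm vu _ ax _ => //; first lra.
  by move=> m' /k1max h; exact: le_lt_trans h a1.
have um : u < b m by exact: lt_le_trans bm.
have /negP := chain_under_square mi Ua (ltW ma1) (ltW ma2) um; apply.
have rm : r j <= l m.
  apply: separated_right => //; first by move=> e; rewrite -e ltnn in mj.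
  - by lra.
  - by lra.
  - by lra.
have btj : b m < t j by lra.
exact: chain_right_of_overhang bk vu ax (ltn_trans mj ji) mi bm btj rm.
Qed.

(** The point [(xj, b j)] is a limit of points of [U] just below it. *)
Lemma overhang_adjacent : adjacent_to (Sq s p j) U.
Proof.
have [ax aj la] := overhang_abscissa; exists (xj, b j); split; last first.
  by split; rewrite /= ?la ?aj // lexx lerDl ltW // s_gt0.
move=> B /nbhs_ballP [e /= e0 He].
have cv : Num.max y (b j - e) < b j.
  by rewrite gt_max yj /= ltrBlDr ltrDl.
have yc : y <= Num.max y (b j - e) by rewrite le_max lexx.
have [u vu cu] := ex_level_above yc cv; exists (xj, u); split.
  exact: below_overhang.
apply: He; split; rewrite /ball /= ?subrr ?normr0 //.
have [_ uj _] := vu; move: cu; rewrite gt_max => /andP[_ cu].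
by rewrite ger0_norm; lra.
Qed.

Lemma rightmost_adjacent v k : y < v -> v <= b j -> rightmost v k ->
  adjacent_to (Sq s p k) U.
Proof.
move=> yv vj [[ki bv vt rx] kmax]; have [u vu] := ex_level yv.
have sk := s_gt0 ki; have [yu uv H] := vu; have [Hb _] := H k ki.
have [l0 _ _] := square_in_strip ki.
exists (r k, u); split; last first.
  split; rewrite /= ?lexx ?lerDl ?(ltW sk) //.
  by rewrite ltW ?Hb //= (le_trans (ltW uv)).
move=> B /nbhs_ballP [e /= e0 He].
pose c := Num.min x (r k + e / 2).
have cx : c <= x by rewrite ge_min lexx.
have ce : c <= r k + e / 2 by rewrite ge_min lexx orbT.
have rc : r k < c by rewrite lt_min rx ltrDl divr_gt0.
exists (c, u); split.
  apply: row_to_arm vu _ cx _ => //; first exact: le_trans vj jA.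
    by apply: le_trans (ltW rc); lra.
  by move=> m /kmax rm; exact: le_lt_trans rc.
apply: He; split; rewrite /ball /= ?subrr ?normr0 //.
by rewrite ler0_norm; lra.
Qed.

Lemma point_covered : exists k, [/\ (k < i)%N, adjacent_to (Sq s p k) U &
  exists2 q, q \in translates k & csquare q (s k) (x, y)].
Proof.
apply: contrapT => nc.
have {}nc k q : (k < i)%N -> adjacent_to (Sq s p k) U -> q \in translates k ->
    q.1 <= x -> x <= q.1 + s k -> q.2 <= y -> y <= q.2 + s k -> False.
  move=> ki ak qk h1 h2 h3 h4; apply: nc; exists k; split=> //.
  by exists q => //; split; apply/andP.
(* The heart of the argument: seen from an uncovered point, the visible squares
   on the left are farther away than they are high. *)
have J k : (k < i)%N -> forall v, y < v -> v <= b j -> rightmost v k ->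
    t k - y < x - r k.
  move: k; apply: (@ltr_ind R (fun k => b k)) => k ki IH v yv vj vk.
  have ak := rightmost_adjacent yv vj vk; have sk := s_gt0 ki.
  have [[_ bv vt rx] _] := vk.
  have [yb|yb] := ltP y (b k); last first.
    have := nc k (r k, b k) ki ak; rewrite !inE eqxx /= => H.
    by rewrite ltNge; apply/negP => xs; apply: H => //; lra.
  have bj : b k <= b j by exact: le_trans (ltW bv) vj.
  have [k1 k1b] := ex_rightmost yb bj; have [[k1i bk1 tk1 rk1] _] := k1b.
  have w := lower_square_wide yb vj vk k1b.
  have h := IH k1 k1i bk1 (b k) yb bj k1b.
  (* By [h] and [w], [b k - y < s k], so both translates span the height [y]. If the claim failed,
     then [x - r k < 2 * s k] and one of them would contain the point. *)
  have N1 := nc k (r k, b k - s k) ki ak.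
  have N2 := nc k (r k + s k, b k - s k) ki ak.
  rewrite !inE !eqxx !orbT /= in N1, N2.
  rewrite ltNge; apply/negP => xs.
  have [x1|x1] := leP x (r k + s k).
    by apply: N1 => //; lra.
  by apply: N2 => //; lra.
have [k1 k1b] := ex_rightmost yj (lexx _).
have [[k1i bk1 tk1 rk1] k1max] := k1b.
have h := J k1 k1i (b j) yj (lexx _) k1b; have w := overhang_wide k1b.
have rj : r k1 < r j by case: jO => _ _ _ _; apply; split.
have aj := overhang_adjacent.
(* [h] and [w] give [b j - y < s j], and [w] with [rj] gives [x < r j + s j]: these two translates
   of [j] leave no room. *)
have N1 := nc j (l j, b j - s j) ji aj; have N2 := nc j (r j, b j - s j) ji aj.
rewrite !inE !eqxx !orbT /= in N1, N2.
have lj' := lj; have yj' := yj.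
have [x1|x1] := leP x (r j); first by apply: N1 => //; lra.
by apply: N2 => //; lra.
Qed.
End Point.

Lemma right_region_point_covered z : U z -> exists k,
  [/\ (k < i)%N, adjacent_to (Sq s p k) U &
    exists2 q, q \in translates k & csquare q (s k) z].
Proof.
case: z => x y /ex_square_above [A [Ai lA rA yA arm]].
have OA := overhang_above Ai lA rA yA.
have [|j [ji jO jmin]] := @ex_argmin R (fun k => b k) i (overhang x y A).
  by exists A.
have {}jmin k : overhang x y A k -> b j <= b k.
  by move=> kO; apply: jmin => //; case: kO.
exact: (point_covered yA arm jO jmin).
Qed.
End Packing.

(** * Pieces as components of free space, and the assembled cover *)

(** At the first stage whose pieces meet [C], maximality of the piece would swallow all of [C],
    including its point in [U], which avoids earlier pieces. So [C] avoids them too. *)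
Lemma piece_absorbs (R : realType) (W : R) (s : nat -> R) (p : nat -> R * R)
    (i : nat) (U C : set (R * R)) : pieces W s p i U -> connected C ->
  C `<=` strip W `\` \bigcup_(j in [set j | (j < i)%N]) Sq s p j ->
  C `&` U !=set0 -> C `<=` U.
Proof.
move=> [[x [Ax ->]] _] Cc Cfree [c0 [Cc0 Uc0]].
have [_ nc0] := connected_component_sub Uc0.
have prev_mono m : (m <= i)%N -> prev_pieces W s p m `<=` prev_pieces W s p i.
  elim: (i) => [|k IH]; first by rewrite leqn0 => /eqP ->.
  rewrite leq_eqVlt => /predU1P[->//|]; rewrite ltnS => /IH mk.
  by move=> w /mk; left.
have free_mono m : (m <= i)%N ->
    C `<=` strip W `\` \bigcup_(j in [set j | (j < m)%N]) Sq s p j.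
  move=> mi w /Cfree [sw nw]; split=> // -[j jm jw]; apply: nw.
  by exists j => //=; exact: leq_trans mi.
have disj m : (m <= i)%N -> forall w, C w -> ~ prev_pieces W s p m w.
  elim: m => [_ w _ []|m IH mi w Cw [|[P Pb Pw]]].
    exact: IH (ltnW mi) w Cw.
  apply: nc0; apply: (prev_mono m.+1 mi); right; exists P => //.
  have [[x' [_ eP]] _] := Pb; move: Pw; rewrite eP => Pw.
  rewrite (same_connected_component Pw).
  apply: (connected_component_max Cw _ Cc Cc0) => w' Cw'.
  by split; [exact: free_mono (ltnW mi) w' Cw'|exact: IH (ltnW mi) w' Cw'].
rewrite (same_connected_component Uc0).
apply: connected_component_max => // w Cw.
by split; [exact: Cfree|exact: disj (leqnn i) w Cw].
Qed.

Lemma count_flatten_translates (R : realType) (s : nat -> R) (p : nat -> R * R)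
    (ks : seq nat) (j : nat) : uniq ks ->
  (count (fun c => c.1 == j)
    (flatten [seq [seq (k, q) | q <- translates s p k] | k <- ks]) <= 4)%N.
Proof.
move=> uks; have -> : count (fun c => c.1 == j)
    (flatten [seq [seq (k, q) | q <- translates s p k] | k <- ks]) =
    (4 * count_mem j ks)%N.
  elim: ks {uks} => //= k ks IH.
  by rewrite IH mulnDr; case: (k == j).
by rewrite count_uniq_mem //; case: (j \in ks).
Qed.
Unset Implicit Arguments.

Theorem theorem10 (R : realType) (W : R) (s : nat -> R) (n : nat)
  (p : nat -> R * R) (i : nat) (U : set (R * R)) :
  0 < W ->
  (forall j, (j < n)%N -> 0 < s j /\ s j <= W) ->
  BL_packing W s n p ->
  (0 < i <= n)%N ->
  pieces W s p i U ->
  right_piece W U ->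
  exists cover : seq (nat * (R * R)),
    (forall c, c \in cover ->
        (c.1 < i)%N /\ adjacent_to (Sq s p c.1) U) /\
    (forall j, (count (fun c => c.1 == j) cover <= 4)%N) /\
    U `<=` \bigcup_(c in [set c | c \in cover]) csquare c.2 (s c.1).
Proof.
move=> _ s0 BL /andP[_ ni] Ui Ur.
have s_gt0 j : (j < i)%N -> 0 < s j.
  by move=> ji; have [] := s0 j (leq_trans ji ni).
have BLi : BL_packing W s i p by move=> k ki; apply: BL; exact: leq_trans ki ni.
have [dn [lf [dnP lfP]]] := ex_contacts s_gt0 BLi.
have Uc : connected U.
  by have [[x [_ ->]] _] := Ui; exact: component_connected.
have Uf z : U z -> free W s p i z.1 z.2.
  rewrite -freeE; have [[x [_ ->]] _] := Ui.
  by move=> /connected_component_sub [].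
have Ua (C : set (R * R)) : connected C ->
    (forall z, C z -> free W s p i z.1 z.2) -> C `&` U !=set0 -> C `<=` U.
  by move=> Cc Cf; apply: piece_absorbs Ui Cc _ => z /Cf; rewrite -freeE.
have cov := right_region_point_covered s_gt0 BLi dnP lfP Uc Uf Ua (proj2 Ui) Ur.
pose ks := [seq k <- iota 0 i | `[< adjacent_to (Sq s p k) U >]].
exists (flatten [seq [seq (k, q) | q <- translates s p k] | k <- ks]).
split; last split.
- move=> c /flatten_mapP [k].
  rewrite mem_filter mem_iota => /andP[/asboolP ak ki].
  by move=> /mapP [q _ ->].
- by move=> j; apply: count_flatten_translates; rewrite filter_uniq ?iota_uniq.
- move=> z /cov [k [ki ak [q qk zq]]]; exists (k, q); last exact: zq.
  apply/flatten_mapP; exists k; last exact: map_f.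
  by rewrite mem_filter mem_iota ki leq0n !andbT; apply/asboolP.
Qed.
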